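(* Let $k\in\mathbb{K}_N$, $j\in\{1,\dots,m\}$, and let the parameters be chosen as described in the context. Then there is a constant $C>0$, depending on $k,R,M,M^*,\lambda_{j,2}$, such that (at every $x\in\partial B_j$, for any noisy data) $$\|\mathcal{V}^\epsilon(u)-\mathcal{V}(u)\|_2\le C\sum_{1\le\ell_1\le\ell_2\le2}\left(|\Delta^{vv}_{\ell_1,\ell_2}|+|\Delta^{uv}_{\ell_1}|+|\Delta^{uv}_{\ell_2}|+|\Delta^{uu}|\right),$$ where $\|\cdot\|_2$ is the Euclidean norm on $\mathbb{R}^3$.
   Context: Let $a>0$, $\Omega_0=(-a,a)^2$, and let $g,\sigma$ be real functions with compact support in $\Omega_0$, $\sigma\ge0$, $g\in L^2(\Omega_0)$, $\sigma\in L^4(\Omega_0)$. Let $G_k(x,y)=-\frac{\mathrm i}{4}H_0^{(1)}(k|x-y|)$, with $H_0^{(1)}=J_0+\mathrm iY_0$ the Hankel function of the first kind of order zero. The radiated random field (the mild solution of $\Delta u+k^2u=g+\sigma\dot W_x$ in $\mathbb{R}^2$ with the Sommerfeld radiation condition, $\dot W_x$ being white noise) is $$u(x,k)=\int_{\Omega_0}G_k(x,y)g(y)\,\mathrm dy+\int_{\Omega_0}G_k(x,y)\sigma(y)\,\mathrm dW_y.$$ Parameters: $m\ge10$ is an integer, $\tau\ge6$, $k^*=\frac{\pi}{30a}$, $\lambda_{j,1}=\frac12$, and $\mathbb{K}_N=\{\frac{\pi}{a}t:t\in\mathbb{R},t\ge1\}\cup\{k^*\}$. If $k\in\mathbb{K}_N\setminus\{k^*\}$,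 then $R=\tau a$ and $\lambda_{j,2}=\frac12+\frac{\pi}{2kR}$; if $k=k^*$, then $R=6a$ and $\lambda_{j,2}=-\frac32$. Also $M=\frac{20\tau-7}{20\tau}$, $M^*=\frac49$. Geometry: $\nu_s=s\pi/m$; $\partial B_j=\{R(\cos\theta,\sin\theta):\nu_{2j-2}\le\theta\le\nu_{2j}\}$; $z_{j,\ell}=\lambda_{j,\ell}R(\cos\nu_{2j-1},\sin\nu_{2j-1})$, $\ell=1,2$; $r_{j,\ell}=|x-z_{j,\ell}|$ for $x\in\partial B_j$. Write $u_{j,k}=u(\cdot,k)|_{\partial B_j}$ and $v_{j,\ell,k}=(u(\cdot,k)+G_k(\cdot,z_{j,\ell}))|_{\partial B_j}$. Exact and noisy quantities: $\mathbf{Var}^\epsilon(|u_{j,k}|^2)$, $\mathbf{Cov}^\epsilon(|u_{j,k}|^2,|v_{j,\ell,k}|^2)$, $\mathbf{Cov}^\epsilon(|v_{j,\ell_1,k}|^2,|v_{j,\ell_2,k}|^2)$ denote given real-valued noisy measurements (functions on $\partial B_j$) of the corresponding exact variances and covariances (with $\mathbf{Cov}(X,X)=\mathbf{Var}(X)$, and likewise for the noisy version). Put $$\Delta^{vv}_{\ell_1,\ell_2}=\mathbf{Cov}^\epsilon(|v_{j,\ell_1,k}|^2,|v_{j,\ell_2,k}|^2)-\mathbf{Cov}(|v_{j,\ell_1,k}|^2,|v_{j,\ell_2,k}|^2),$$ $$\Delta^{uv}_{\ell}=\mathbf{Cov}^\epsilon(|u_{j,k}|^2,|v_{j,\ell,k}|^2)-\mathbf{Cov}(|u_{j,k}|^2,|v_{j,\ell,k}|^2),\qquad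 \Delta^{uu}=\mathbf{Var}^\epsilon(|u_{j,k}|^2)-\mathbf{Var}(|u_{j,k}|^2),$$ $$F^\epsilon_{j,k,\ell_1,\ell_2}=4\left[\mathbf{Cov}^\epsilon(|v_{j,\ell_1,k}|^2,|v_{j,\ell_2,k}|^2)-\mathbf{Cov}^\epsilon(|u_{j,k}|^2,|v_{j,\ell_1,k}|^2)-\mathbf{Cov}^\epsilon(|u_{j,k}|^2,|v_{j,\ell_2,k}|^2)+\mathbf{Var}^\epsilon(|u_{j,k}|^2)\right].$$ The exact vector is $\mathcal{V}(u)=(\mathbf{Var}(\operatorname{Re}u_{j,k}),\mathbf{Var}(\operatorname{Im}u_{j,k}),\mathbf{Cov}(\operatorname{Re}u_{j,k},\operatorname{Im}u_{j,k}))^\top$. The recovered vector $\mathcal{V}^\epsilon(u)=(\mathbf{Var}^\epsilon(\operatorname{Re}u_{j,k}),\mathbf{Var}^\epsilon(\operatorname{Im}u_{j,k}),\mathbf{Cov}^\epsilon(\operatorname{Re}u_{j,k},\operatorname{Im}u_{j,k}))^\top$ is, pointwise in $x\in\partial B_j$, the solution of the $3\times3$ linear system $$D_{j,k}\,\mathcal{V}^\epsilon(u)=(F^\epsilon_{j,k,1,1},F^\epsilon_{j,k,2,2},F^\epsilon_{j,k,1,2})^\top,$$ $$D_{j,k}=\begin{pmatrix}Y_0^2(kr_{j,1})&J_0^2(kr_{j,1})&-2Y_0(kr_{j,1})J_0(kr_{j,1})\\ Y_0^2(kr_{j,2})&J_0^2(kr_{j,2})&-2Y_0(kr_{j,2})J_0(kr_{j,2})\\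 Y_0(kr_{j,1})Y_0(kr_{j,2})&J_0(kr_{j,1})J_0(kr_{j,2})&-Y_0(kr_{j,1})J_0(kr_{j,2})-Y_0(kr_{j,2})J_0(kr_{j,1})\end{pmatrix}.$$ *)

(* Defs.v *)
From HB Require Import structures.
From mathcomp Require Import all_boot all_order all_algebra.
From mathcomp Require Import complex.
From mathcomp Require Import all_classical all_reals all_analysis.

Set Implicit Arguments.
Unset Strict Implicit.
Unset Printing Implicit Defensive.

Import Order.TTheory GRing.Theory Num.Theory.
Import numFieldNormedType.Exports.

Local Open Scope classical_set_scope.
Local Open Scope ring_scope.
Local Open Scope complex_scope.

Section bessel.
Context {R : realType}.
Implicit Types (x : R) (n : nat).

(* The order-zero Bessel functions are given by their classical series
   (DLMF 10.2.2 and 10.8.2); [besselY0] is only meaningful for x > 0. *)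
Definition besselJ0 x : R :=
  limn (series (fun n => (-1) ^+ n / (n`!%:R) ^+ 2 * (x / 2) ^+ (2 * n))).

Definition harmonic_number n : R := \sum_(1 <= i < n.+1) i%:R^-1.

Definition euler_gamma : R := limn (fun n => harmonic_number n - ln n%:R).

Definition besselY0 x : R :=
  2 / pi * (ln (x / 2) + euler_gamma) * besselJ0 x
  + 2 / pi * limn (series (fun n =>
      (-1) ^+ n.+1 * harmonic_number n / (n`!%:R) ^+ 2 * (x / 2) ^+ (2 * n))).

Definition hankel0 x : R[i] := besselJ0 x +i* besselY0 x.

End bessel.

Section plane.
Context {R : realType}.
Implicit Types (a k : R) (x y : R * R).

(* The canonical norm on the product type R * R is the sup norm. *)
Definition euclid_dist x y : R := Num.sqrt ((x.1 - y.1) ^+ 2 + (x.2 - y.2) ^+ 2).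

Definition lebesgue2 :=
  ((@lebesgue_measure R) \x (@lebesgue_measure R))%E.

Definition Omega0 a : set (R * R) := [set y | - a < y.1 < a /\ - a < y.2 < a].

Definition compactly_supported_in (D : set (R * R)) (f : R * R -> R) : Prop :=
  compact (closure [set y | f y != 0]) /\ closure [set y | f y != 0] `<=` D.

Definition Lp_on (D : set (R * R)) (p : R) (f : R * R -> R) : Prop :=
  f \_ D \in Lfun lebesgue2 p%:E.

Definition green k x y : R[i] := - ((0 +i* 1) / 4%:R) * hankel0 (k * euclid_dist x y).

Definition complex_integral (D : set (R * R)) (f : R * R -> R[i]) : R[i] :=
  (\int[lebesgue2]_(y in D) complex.Re (f y)) +i*
  (\int[lebesgue2]_(y in D) complex.Im (f y)).

End plane.

Section white_noise.
Context {R : realType} d {T : measurableType d} (P : probability T R).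

(* The null variable is separated because [normal_prob 0 0] is not the Dirac
   mass at 0 but, by convention, a uniform law. *)
Definition centered_gaussian (X : T -> R) : Prop :=
  {ae P, forall w, X w = 0} \/
  exists2 s : R, 0 < s &
    forall A, measurable A -> P (X @^-1` A) = normal_prob 0 s A.

(* White noise on D is the isonormal Gaussian process over L^2(D), whose value
   [W f] is the Wiener integral of f. Its values off L^2(D) are irrelevant. *)
Record white_noise (D : set (R * R)) (W : (R * R -> R) -> {RV P >-> R}) :
    Prop := WhiteNoise {
  white_noise_gaussian : forall n (f : 'I_n -> R * R -> R) (c : 'I_n -> R),
    (forall i, Lp_on D 2 (f i)) ->
    centered_gaussian (fun w => \sum_(i < n) c i * W (f i) w) ;
  white_noise_isometry : forall f g, Lp_on D 2 f -> Lp_on D 2 g ->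
    covariance P (W f) (W g) = (\int[lebesgue2]_(y in D) (f y * g y))%:E
}.

Definition complex_wiener (W : (R * R -> R) -> {RV P >-> R})
    (f : R * R -> R[i]) (w : T) : R[i] :=
  (W (fun y => complex.Re (f y)) w) +i* (W (fun y => complex.Im (f y)) w).

Definition radiated (W : (R * R -> R) -> {RV P >-> R}) (a : R)
    (g sigma : R * R -> R) (k : R) (x : R * R) (w : T) : R[i] :=
  complex_integral (Omega0 a) (fun y => green k x y * (g y)%:C)
  + complex_wiener W (fun y => green k x y * (sigma y)%:C) w.

(* The library covariance and variance are extended reals. *)
Definition rcov (X Y : T -> R) : R := fine (covariance P X Y).
Definition rvar (X : T -> R) : R := fine ('V_P[X])%E.

Definition sqmod (X : T -> R[i]) (w : T) : R := Normc.normc (X w) ^+ 2.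

End white_noise.

Section geometry.
Context {R : realType}.
Implicit Types (a tau k : R) (m j l : nat).

Definition kstar a : R := pi / (30 * a).

Definition wavenumbers a : set R :=
  [set pi / a * t | t in [set t | 1 <= t]] `|` [set kstar a].

Definition obs_radius a tau k : R := if k == kstar a then 6 * a else tau * a.

Definition lambda a tau k l : R :=
  if l == 1%N then 1 / 2
  else if k == kstar a then - (3 / 2)
  else 1 / 2 + pi / (2 * k * obs_radius a tau k).

Definition nu m (s : nat) : R := s%:R * pi / m%:R.

Definition boundary_arc a tau k m j : set (R * R) :=
  [set (obs_radius a tau k * cos theta, obs_radius a tau k * sin theta) |
    theta in [set theta | nu m (2 * j - 2) <= theta <= nu m (2 * j)]].

Definition refpoint a tau k m j l : R * R :=
  (lambda a tau k l * obs_radius a tau k * cos (nu m (2 * j - 1)),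
   lambda a tau k l * obs_radius a tau k * sin (nu m (2 * j - 1))).

Definition vec3 (p q r : R) : 'cV[R]_3 := \col_(i < 3) [:: p; q; r]`_i.

Definition norm2 (v : 'cV[R]_3) : R := Num.sqrt (\sum_(i < 3) v i 0 ^+ 2).

Definition recovery_matrix a tau k m j (x : R * R) : 'M[R]_3 :=
  let r l := euclid_dist x (refpoint a tau k m j l) in
  let Y l := besselY0 (k * r l) in
  let J l := besselJ0 (k * r l) in
  \matrix_(s < 3, t < 3) (nth [::] [::
    [:: Y 1%N ^+ 2; J 1%N ^+ 2; - (2 * Y 1%N * J 1%N)];
    [:: Y 2%N ^+ 2; J 2%N ^+ 2; - (2 * Y 2%N * J 2%N)];
    [:: Y 1%N * Y 2%N; J 1%N * J 2%N; - (Y 1%N * J 2%N) - Y 2%N * J 1%N]] s)`_t.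

End geometry.

(* Main.v *)
Require Import Defs.
From HB Require Import structures.
From mathcomp Require Import all_boot all_order all_algebra.
From mathcomp Require Import complex.
From mathcomp Require Import all_classical all_reals all_analysis.
From mathcomp Require Import measurable_realfun ring lra.

Set Implicit Arguments.
Unset Strict Implicit.
Unset Printing Implicit Defensive.

Import Order.TTheory GRing.Theory Num.Theory.
Import numFieldNormedType.Exports.

Local Open Scope classical_set_scope.
Local Open Scope ring_scope.
Local Open Scope complex_scope.

(** Write [v_l = u + G_l], where [G_l] is the Green function at the reference
    point [z_l]. Then [|v_l|^2 = |u|^2 + X_l], where [X_l] is a deterministic
    constant plus [2 Re G_l Re u + 2 Im G_l Im u]. By bilinearity of the
    covariance, the combination

      [Cov(|v_1|^2, |v_2|^2) - Cov(|u|^2, |v_1|^2) - Cov(|u|^2, |v_2|^2) + Var |u|^2]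

    equals [Cov(X_1, X_2)], a linear expression in the second moments of
    [Re u] and [Im u]. Since [Re G_l] and [Im G_l] are [Y0 / 4] and [- J0 / 4],
    the exact moments solve the recovery system with exact data
    ([second_difference_radiated]), so the error of the recovered moments solves
    the same system with the data errors on the right. Bilinearity needs
    [|u|^2] to be square integrable: [u] is a constant plus Wiener integrals of
    square integrable kernels ([Lp_on_radial_mul]; an observation point stays
    away from the source region, where the Green function is bounded), and a
    Gaussian variable has a finite fourth moment
    ([sqr_centered_gaussian_Lfun2]).

    The recovery system transforms the symmetric 2 x 2 matrix of moments by
    congruence with the matrix of rows [(Y0(k r_l), - J0(k r_l))]. It is solved
    explicitly after division by the square of
    [w = J0(k r_1) Y0(k r_2) - J0(k r_2) Y0(k r_1)]
    ([symmetric_system_bound]), and everything reduces to a lower bound on [|w|].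

    The crux is that [w] does not vanish: [bessel_cross_product_neq0] states that
    no nontrivial combination of [J0] and [Y0] has two positive zeros at a
    distance less than 2. In the variable [t = (x / 2)^2] such a combination solves
    [t f'' + f' + f = 0]. The function [phi = m + B ln (t / B) - (t - B)]
    satisfies [t phi'' + phi' + phi = phi - 1], so it is a positive strict
    supersolution wherever [0 < phi < 1], and suitable [m] and [B] achieve this
    between the two zeros. The quantity [t (f' phi - f phi') f / phi] vanishes at
    both zeros and has a nonnegative derivative, so Rolle's theorem gives a point
    at which [f] and [f'] vanish together; the Wronskian of [J0] and [Y0] forbids
    that. On each observation arc the two arguments are distinct
    and differ by at most [pi / 2] ([chord_separation]).

    It remains to make the bound uniform. An arc point enters [w] only through
    the cosine [c] of its angle to the middle of the arc, and [c] ranges over a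
    subset of [[7/10, 1]] whatever [m] and [j] are. By compactness the condition
    number is bounded for given [k R] and [lambda_2], and that bound, up to a
    numerical factor, is the constant of the theorem. *)

(** * Power series with factorially decaying coefficients *)

Section entire_series.
Context {R : realType}.
Implicit Types (c e : R^nat) (t x : R) (n : nat).

(** A class of coefficient sequences with entire sums which contains those of
    the Bessel series and is stable under termwise differentiation, so that sums
    may be differentiated any number of times. *)
Definition factorially_bounded c := forall n, `|c n| <= n`!%:R^-1.

Definition psum c t : R := limn (pseries c t).

Lemma factorially_bounded_diffs c :
  factorially_bounded c -> factorially_bounded (pseries_diffs c).
Proof.
move=> cb n; rewrite /pseries_diffs normrM ger0_norm//.
by rewrite -ler_pdivlMl// (le_trans (cb _))// factS natrM invfM.
Qed.

Lemma is_cvg_factorially_bounded c t :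
  factorially_bounded c -> cvgn (pseries c t).
Proof.
move=> cb; apply: normed_cvg.
apply: series_le_cvg (is_cvg_series_exp_coeff `|t|) => n /=.
- exact: normr_ge0.
- exact: exp_coeff_ge0.
- by rewrite normrM normrX exp_coeffE /= ler_wpM2r// exprn_ge0.
Qed.

Lemma is_derive_psum c t : factorially_bounded c ->
  is_derive t 1 (psum c) (psum (pseries_diffs c) t).
Proof.
move=> cb; apply: (@pseries_snd_diffs _ c (`|t| + 1)).
- exact: is_cvg_factorially_bounded.
- exact/is_cvg_factorially_bounded/factorially_bounded_diffs.
- exact/is_cvg_factorially_bounded/factorially_bounded_diffs/factorially_bounded_diffs.
- by rewrite [ltRHS]ger0_norm ?ltrDl// addr_ge0.
Qed.

Lemma psum0 c : psum c 0 = c 0%N.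
Proof.
apply/cvg_lim => //; rewrite -cvg_shiftS /pseries.
rewrite (_ : (fun n => _) = cst (c 0%N)); first exact: cvg_cst.
apply/funext => n /=; rewrite /series/= big_nat_recl//= expr0 mulr1.
by rewrite big1 ?addr0// => i _; rewrite expr0n/= mulr0.
Qed.

(** Frobenius' method: the coefficient of [t ^ n] in [t C'' + C' + C] is
    [(n + 1)^2 c_(n+1) + c_n]. The identity is proved for partial sums, with the
    second derivative truncated one term earlier since it is multiplied by [t],
    and then passes to the limit. *)
Lemma bessel_ode_psum c e t : factorially_bounded c -> factorially_bounded e ->
  (forall n, n.+1%:R ^+ 2 * c n.+1 + c n = e n) ->
  t * psum (pseries_diffs (pseries_diffs c)) t
    + psum (pseries_diffs c) t + psum c t = psum e t.
Proof.
move=> cb eb rec.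
have cdb := factorially_bounded_diffs cb.
have cddb := factorially_bounded_diffs cdb.
have partial n : t * pseries (pseries_diffs (pseries_diffs c)) t n
    + pseries (pseries_diffs c) t n.+1 + pseries c t n.+1 = pseries e t n.+1.
  elim: n => [|n IH].
    rewrite /pseries /series /= !big_nat1 big_geq// mulr0 add0r !expr0 !mulr1.
    by rewrite -rec /pseries_diffs expr1n.
  rewrite /pseries in IH *; rewrite !(seriesSr _ n) !(seriesSr _ n.+1).
  rewrite -IH /= -(rec n.+1) /pseries_diffs exprS; ring.
have to_e : (fun n => pseries e t n.+1) @ \oo --> psum e t.
  by have := is_cvg_factorially_bounded (t := t) eb; rewrite -cvg_shiftS.
move: to_e; rewrite -(funext partial) => /cvg_lim <-//.
apply/esym/cvg_lim => //; apply: cvgD; first apply: cvgD.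
- by apply: cvgMr; exact: (is_cvg_factorially_bounded (t := t) cddb).
- by have := is_cvg_factorially_bounded (t := t) cdb; rewrite -cvg_shiftS.
- by have := is_cvg_factorially_bounded (t := t) cb; rewrite -cvg_shiftS.
Qed.

End entire_series.

(** * Close zeros of solutions of t f'' + f' + f = 0 *)

Section bessel_oscillation.
Context {R : realType}.
Implicit Types (f : R -> R) (t x : R).

Lemma is_derive_inv f t (df : R) : f t != 0 -> is_derive t 1 f df ->
  is_derive t 1 (fun s => (f s)^-1) (- df / f t ^+ 2).
Proof.
move=> ft0 [dft <-]; apply: DeriveDef; first exact: derivableV.
by rewrite deriveV// /GRing.scale /= mulrC mulNr -mulrN.
Qed.

(** A quantitative Sturm argument. In the Bessel variable [x = 2 sqrt t]
    the two zeros are [2 x1] and [2 x2], at a distance less than 2. The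
    conclusion excludes every nontrivial solution as soon as a Wronskian is
    known. *)
Lemma common_zero_of_close_zeros (f f1 f2 : R -> R) (x1 x2 : R) :
  (forall t, 0 < t -> is_derive t 1 f (f1 t)) ->
  (forall t, 0 < t -> is_derive t 1 f1 (f2 t)) ->
  (forall t, 0 < t -> t * f2 t + f1 t + f t = 0) ->
  0 < x1 -> x1 < x2 -> x2 < x1 + 1 ->
  f (x1 ^+ 2) = 0 -> f (x2 ^+ 2) = 0 ->
  exists2 t, 0 < t & f t = 0 /\ f1 t = 0.
Proof.
move=> df df1 ode x10 x12 x21 fx1 fx2.
(* [B] is the point where [phi] is maximal, with value [m < 1]. Choosing it as
   the geometric mean of the zeros makes
   [(x2 - x1)^2 t - (t - B)^2] factor as [(t - x1^2) (x2^2 - t)], which gives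
   [m - phi t <= (x2 - x1)^2 < m] between the zeros. *)
pose B := x1 * x2; pose m := (1 + (x2 - x1) ^+ 2) / 2.
pose phi t := m + B * (ln t - ln B) - (t - B).
have x20 : 0 < x2 by exact: lt_trans x12.
have B0 : 0 < B by exact: mulr_gt0.
have t12 : x1 ^+ 2 < x2 ^+ 2 by nra.
have phi_itv t : x1 ^+ 2 <= t <= x2 ^+ 2 -> 0 < phi t < 1.
  move=> /andP[t1 t2].
  have t0 : 0 < t by rewrite (lt_le_trans _ t1)// exprn_gt0.
  have lnB : ln (t / B) = ln t - ln B by rewrite ln_div ?posrE.
  have up : ln (t / B) <= t / B - 1.
    by rewrite -ler_expR lnK ?posrE ?divr_gt0// (le_trans _ (expR_ge1Dx _))// addrC subrK.
  have lo : ln (B / t) <= B / t - 1.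
    by rewrite -ler_expR lnK ?posrE ?divr_gt0// (le_trans _ (expR_ge1Dx _))// addrC subrK.
  have lnN : ln (B / t) = - ln (t / B).
    by rewrite -lnV ?posrE ?divr_gt0// invf_div.
  have gap : (t - B) ^+ 2 <= (x2 - x1) ^+ 2 * t.
    rewrite -subr_ge0 (_ : _ - _ = (t - x1 ^+ 2) * (x2 ^+ 2 - t)); last by rewrite /B; ring.
    by rewrite mulr_ge0// subr_ge0.
  have lo' : (t - B) - B * ln (t / B) <= (x2 - x1) ^+ 2.
    apply: (@le_trans _ _ ((t - B) ^+ 2 / t)); last by rewrite ler_pdivrMr.
    rewrite lnN in lo.
    have : B * (1 - B / t) <= B * ln (t / B) by rewrite ler_wpM2l ?(ltW B0)//; lra.
    rewrite (_ : (t - B) ^+ 2 / t = t - B - B * (1 - B / t)); first by lra.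
    by field; rewrite gt_eqF.
  have up' : B * ln (t / B) <= t - B.
    rewrite (_ : t - B = B * (t / B - 1)) ?ler_wpM2l ?(ltW B0)//.
    by field; rewrite gt_eqF.
  have : (x2 - x1) ^+ 2 < 1 by nra.
  by rewrite /phi /m -lnB => ?; apply/andP; split; lra.
have dphi t : 0 < t -> is_derive t 1 phi (B / t - 1).
  move=> t0; have dln := is_derive1_ln t0.
  rewrite /phi; apply: is_derive_eq.
  by rewrite /GRing.scale /=; ring.
(* [E = t (f' phi - f phi') f / phi], using [t phi' = B - t]. Its derivative is a
   sum of two nonnegative terms that vanish together only where [f = f' = 0]. *)
pose E t := t * f1 t * f t - f t ^+ 2 * (B - t) / phi t.
pose E' t := f t ^+ 2 * ((phi t)^-1 - 1)
           + t * (f1 t - f t * (B - t) / (t * phi t)) ^+ 2.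
have dE t : x1 ^+ 2 <= t <= x2 ^+ 2 -> is_derive t 1 E (E' t).
  move=> tI; have [phi0 phi1] := andP (phi_itv _ tI).
  have t0 : 0 < t by have /andP[t1 _] := tI; rewrite (lt_le_trans _ t1)// exprn_gt0.
  have := dphi t t0; have := df t t0; have := df1 t t0 => d1 d2 d3.
  have d4 := is_derive_inv (lt0r_neq0 phi0) d3.
  rewrite /E; apply: is_derive_eq.
  have phiN0 : phi t != 0 by exact: lt0r_neq0.
  have tN0 : t != 0 by exact: lt0r_neq0.
  have -> : f2 t = - (f1 t + f t) / t.
    by have := ode t t0 => o; apply: (mulfI tN0); rewrite mulrCA divff// mulr1; lra.
  by rewrite /E' /GRing.scale /= ?fctE/=; field; apply/andP.
have [|//||c cI dc] := Rolle t12 (f := E).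
- by move=> t /[!in_itv]/= /andP[t1 t2]; apply: ex_derive; apply: dE; rewrite !ltW.
- apply: derivable_within_continuous => t /[!in_itv]/= tI.
  by apply: ex_derive; exact: dE.
- by rewrite /E fx1 fx2 expr0n/=; lra.
have {}cI : x1 ^+ 2 <= c <= x2 ^+ 2.
  by move: cI; rewrite in_itv/= => /andP[c1 c2]; rewrite !ltW.
have c0 : 0 < c by have /andP[c1 _] := cI; rewrite (lt_le_trans _ c1)// exprn_gt0.
have [phi0 phi1] := andP (phi_itv _ cI).
have E'0 : E' c = 0 by rewrite -(derive_val (is_derive := dE c cI)) derive_val.
have gap0 : 0 < (phi c)^-1 - 1 by rewrite subr_gt0 invf_gt1.
exists c => //.
have fc0 : f c = 0.
  apply/eqP; rewrite -sqrf_eq0; apply/eqP.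
  have := sqr_ge0 (f1 c - f c * (B - c) / (c * phi c)).
  have := sqr_ge0 (f c); rewrite /E' in E'0; nra.
split=> //; move: E'0; rewrite /E' fc0 expr0n/= mul0r add0r !mul0r subr0.
by move=> /eqP; rewrite mulf_eq0 gt_eqF//= sqrf_eq0 => /eqP.
Qed.

End bessel_oscillation.

(** * The functions J0 and Y0 *)

Section bessel_functions.
Context {R : realType}.
Implicit Types (s t x y : R) (n : nat).

Definition bessel_coef n : R := (-1) ^+ n / n`!%:R ^+ 2.
Definition neumann_coef n : R :=
  (-1) ^+ n.+1 * harmonic_number n / n`!%:R ^+ 2.

Lemma sqr_factS n : n.+1`!%:R ^+ 2 = n.+1%:R ^+ 2 * n`!%:R ^+ 2 :> R.
Proof. by rewrite factS natrM exprMn. Qed.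

Lemma bessel_coefS n :
  n.+1%:R ^+ 2 * bessel_coef n.+1 = - bessel_coef n.
Proof.
have : n`!%:R != 0 :> R by rewrite pnatr_eq0 -lt0n fact_gt0.
have : n.+1%:R != 0 :> R by rewrite pnatr_eq0.
rewrite /bessel_coef sqr_factS (exprS _ n).
move: (_ ^+ n) (n`!%:R : R) (n.+1%:R : R) => e f a a0 f0.
by field; apply/andP.
Qed.

Lemma bessel_coef_bounded : factorially_bounded bessel_coef.
Proof.
move=> n; rewrite normrM normrX normrN1 expr1n mul1r ger0_norm ?invr_ge0 ?sqr_ge0//.
have f1 : 1 <= n`!%:R :> R by rewrite ler1n fact_gt0.
by rewrite lef_pV2 ?posrE ?exprn_gt0 ?(lt_le_trans _ f1)// expr2 ler_peMl// (le_trans _ f1).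
Qed.

Lemma harmonic_numberS n :
  harmonic_number n.+1 = harmonic_number n + n.+1%:R^-1 :> R.
Proof. by rewrite /harmonic_number big_nat_recr. Qed.

Lemma harmonic_number_ge0 n : 0 <= harmonic_number n :> R.
Proof. by apply: sumr_ge0 => i _; rewrite invr_ge0. Qed.

Lemma harmonic_number_le_fact n : harmonic_number n <= n`!%:R :> R.
Proof.
apply: (@le_trans _ _ n%:R); last by rewrite ler_nat; elim: n => // n IH; rewrite factS leq_pmulr// fact_gt0.
elim: n => [|n IH]; first by rewrite /harmonic_number big_geq.
by rewrite harmonic_numberS -[leRHS]natr1 lerD// invf_le1// ler1n.
Qed.

Lemma neumann_coef_bounded : factorially_bounded neumann_coef.
Proof.
move=> n; rewrite !normrM normrX normrN1 expr1n mul1r.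
rewrite ger0_norm ?harmonic_number_ge0// ger0_norm ?invr_ge0 ?sqr_ge0//.
have f0 : 0 < n`!%:R :> R by rewrite ltr0n fact_gt0.
by rewrite ler_pdivrMr ?exprn_gt0// expr2 mulKf ?gt_eqF// harmonic_number_le_fact.
Qed.

(** Bessel-Clifford form of [J0]: the entire function [cliffJ] with
    [J0 x = cliffJ ((x / 2) ^ 2)]. Passing to [t = (x / 2)^2] turns the Bessel
    equation into [t f'' + f' + f = 0] and makes the power series ordinary. *)
Definition cliffJ := psum bessel_coef.
Definition dcliffJ := psum (pseries_diffs bessel_coef).
Definition ddcliffJ := psum (pseries_diffs (pseries_diffs bessel_coef)).

Lemma cliffJ_ode t : t * ddcliffJ t + dcliffJ t + cliffJ t = 0.
Proof.
rewrite (bessel_ode_psum t bessel_coef_bounded (e := fun=> 0)).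
- apply/cvg_lim => //; rewrite /pseries.
  rewrite (_ : [series _]_i = cst 0); first exact: cvg_cst.
  by apply/funext => n; rewrite /series/= big1// => i _; rewrite mul0r.
- by move=> n; rewrite normr0 invr_ge0.
- by move=> n; rewrite bessel_coefS addNr.
Qed.

Definition cliffH := psum neumann_coef.
Definition dcliffH := psum (pseries_diffs neumann_coef).
Definition ddcliffH := psum (pseries_diffs (pseries_diffs neumann_coef)).

(** The harmonic numbers enter through [H_(n+1) - H_n = 1 / (n+1)], which leaves
    the coefficient [- (n+1) a_(n+1)] of [- cliffJ'] in the recurrence. *)
Lemma cliffH_ode t : t * ddcliffH t + dcliffH t + cliffH t = - dcliffJ t.
Proof.
have db := factorially_bounded_diffs bessel_coef_bounded.
rewrite (bessel_ode_psum t neumann_coef_bounded (e := \- pseries_diffs bessel_coef)).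
- apply/cvg_lim => //.
  rewrite (_ : pseries _ t = - pseries (pseries_diffs bessel_coef) t).
    by apply: cvgN; exact: (is_cvg_factorially_bounded (t := t) db).
  apply/funext => n; rewrite /pseries !fctE /series/= -sumrN.
  by apply: eq_bigr => i _; rewrite mulNr.
- by move=> n; rewrite /= normrN.
- move=> n; have := bessel_coefS n.
  rewrite /= /neumann_coef /pseries_diffs /bessel_coef harmonic_numberS => _.
  have : n`!%:R != 0 :> R by rewrite pnatr_eq0 -lt0n fact_gt0.
  have : n.+1%:R != 0 :> R by rewrite pnatr_eq0.
  rewrite sqr_factS (exprS _ n.+1) (exprS _ n).
  move: (_ ^+ n) (n`!%:R : R) (n.+1%:R : R) (harmonic_number n) => e f a h a0 f0.
  by field; apply/andP.
Qed.

Lemma is_derive_cliffJ t : is_derive t 1 cliffJ (dcliffJ t).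
Proof. exact: is_derive_psum bessel_coef_bounded. Qed.

Lemma is_derive_dcliffJ t : is_derive t 1 dcliffJ (ddcliffJ t).
Proof. exact: is_derive_psum (factorially_bounded_diffs bessel_coef_bounded). Qed.

Lemma is_derive_cliffH t : is_derive t 1 cliffH (dcliffH t).
Proof. exact: is_derive_psum neumann_coef_bounded. Qed.

Lemma is_derive_dcliffH t : is_derive t 1 dcliffH (ddcliffH t).
Proof. exact: is_derive_psum (factorially_bounded_diffs neumann_coef_bounded). Qed.

(** The second solution, normalized so that [Y0 x = cliffN ((x / 2) ^ 2) / pi];
    [ln t] is [2 ln (x / 2)]. *)
Definition cliffN t := (ln t + 2 * euler_gamma) * cliffJ t + 2 * cliffH t.
Definition dcliffN t :=
  cliffJ t / t + (ln t + 2 * euler_gamma) * dcliffJ t + 2 * dcliffH t.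
Definition ddcliffN t := 2 * dcliffJ t / t - cliffJ t / t ^+ 2
  + (ln t + 2 * euler_gamma) * ddcliffJ t + 2 * ddcliffH t.

Lemma cliffN_ode t : 0 < t -> t * ddcliffN t + dcliffN t + cliffN t = 0.
Proof.
move=> t0; have /eqP tN0 := lt0r_neq0 t0.
have -> : t * ddcliffN t + dcliffN t + cliffN t =
   2 * (t * ddcliffH t + dcliffH t + cliffH t + dcliffJ t)
   + (ln t + 2 * euler_gamma) * (t * ddcliffJ t + dcliffJ t + cliffJ t).
  by rewrite /ddcliffN /dcliffN /cliffN; field; apply/eqP.
by rewrite cliffJ_ode cliffH_ode addNr !mulr0 addr0.
Qed.

Lemma is_derive_cliffN t : 0 < t -> is_derive t 1 cliffN (dcliffN t).
Proof.
move=> t0; have := is_derive1_ln t0; have := is_derive_cliffJ t.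
have := is_derive_cliffH t => d1 d2 d3.
rewrite /cliffN; apply: is_derive_eq.
by rewrite /dcliffN /GRing.scale /=; ring.
Qed.

Lemma is_derive_dcliffN t : 0 < t -> is_derive t 1 dcliffN (ddcliffN t).
Proof.
move=> t0; have := is_derive1_ln t0; have := is_derive_cliffJ t.
have := is_derive_dcliffH t; have := is_derive_dcliffJ t => d1 d2 d3 d4.
have d5 := is_derive_inv (lt0r_neq0 t0) (is_derive_id t (1 : R)).
rewrite /dcliffN; apply: is_derive_eq.
by rewrite /ddcliffN /GRing.scale /=; field; exact: lt0r_neq0.
Qed.

(** The logarithm cancels in the Wronskian, and what is left is an entire
    function with derivative zero; its value can therefore be read off at
    [t = 0], where [cliffN] itself is singular. *)
Lemma wronskian_cliffJN t : 0 < t ->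
  t * (cliffJ t * dcliffN t - dcliffJ t * cliffN t) = 1.
Proof.
move=> t0.
pose K s := cliffJ s ^+ 2
  + 2 * (s * (cliffJ s * dcliffH s - dcliffJ s * cliffH s)).
have dK s : is_derive s 1 K 0.
  have := is_derive_cliffJ s; have := is_derive_dcliffJ s.
  have := is_derive_cliffH s; have := is_derive_dcliffH s => d1 d2 d3 d4.
  rewrite /K; apply: is_derive_eq; rewrite /GRing.scale /=.
  transitivity (2 * (cliffJ s * (s * ddcliffH s + dcliffH s + cliffH s + dcliffJ s)
     - cliffH s * (s * ddcliffJ s + dcliffJ s + cliffJ s))); first by ring.
  by rewrite cliffJ_ode cliffH_ode addNr !mulr0 subrr mulr0.
have KE : K t = t * (cliffJ t * dcliffN t - dcliffJ t * cliffN t).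
  by rewrite /K /dcliffN /cliffN; field; exact: lt0r_neq0.
have K0 : K 0 = 1.
  rewrite /K mul0r mulr0 addr0 /cliffJ psum0 /bessel_coef expr0 fact0.
  by rewrite !expr1n divr1 expr1n.
rewrite -KE -K0.
exact: is_derive_0_is_cst.
Qed.

Lemma besselJ0E x : besselJ0 x = cliffJ ((x / 2) ^+ 2).
Proof.
rewrite /besselJ0 /cliffJ /psum /pseries; congr (limn (series _)).
by apply/funext => n; rewrite exprM.
Qed.

Lemma besselY0E x : 0 < x -> besselY0 x = pi^-1 * cliffN ((x / 2) ^+ 2).
Proof.
move=> x0; rewrite /besselY0 besselJ0E /cliffN lnXn ?divr_gt0//.
have -> : limn (series (fun n => (-1) ^+ n.+1 * harmonic_number n /
    n`!%:R ^+ 2 * (x / 2) ^+ (2 * n))) = cliffH ((x / 2) ^+ 2).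
  rewrite /cliffH /psum /pseries; congr (limn (series _)).
  by apply/funext => n; rewrite exprM.
rewrite -(mulr_natl (ln (x / 2)) 2).
by move: (@pi R) (lt0r_neq0 (pi_gt0 R)) => p p0; field.
Qed.

(** As a function of [y], the cross product solves the Bessel equation and
    vanishes at [x]. A second zero closer than 2 would produce a point where it
    vanishes with its derivative; by the Wronskian at that point both
    [J0 x] and [Y0 x] are zero, which contradicts the Wronskian at [x]. *)
Lemma bessel_cross_product_neq0 x y : 0 < x -> 0 < y -> x != y ->
  `|x - y| < 2 -> besselJ0 x * besselY0 y - besselJ0 y * besselY0 x != 0.
Proof.
wlog xy : x y / x < y.
  move=> H x0 y0; rewrite neq_lt => /orP[xy|yx] d.
    by apply: H => //; rewrite lt_eqF.
  rewrite -oppr_eq0 opprB; apply: H => //; first by rewrite lt_eqF.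
  by rewrite distrC.
move=> x0 y0 _; rewrite ltr0_norm ?subr_lt0// => d.
apply/negP => /eqP; rewrite !besselJ0E !besselY0E// => w0.
have s0 : 0 < (x / 2) ^+ 2 by rewrite exprn_gt0 ?divr_gt0.
set s := (x / 2) ^+ 2 in w0 s0.
pose f t := cliffJ s * cliffN t - cliffN s * cliffJ t.
pose f1 t := cliffJ s * dcliffN t - cliffN s * dcliffJ t.
pose f2 t := cliffJ s * ddcliffN t - cliffN s * ddcliffJ t.
have [| | | | | | | |t t0 [ft f1t]] := @common_zero_of_close_zeros _ f f1 f2 (x / 2) (y / 2).
- move=> t t0; have := is_derive_cliffJ t; have := is_derive_cliffN t0 => d1 d2.
  by rewrite /f; apply: is_derive_eq; rewrite /f1 /GRing.scale /=; ring.
- move=> t t0; have := is_derive_dcliffJ t; have := is_derive_dcliffN t0 => d1 d2.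
  by rewrite /f1; apply: is_derive_eq; rewrite /f2 /GRing.scale /=; ring.
- move=> t t0; have oJ := cliffJ_ode t; have oN := cliffN_ode t0.
  rewrite (_ : _ + f t = cliffJ s * (t * ddcliffN t + dcliffN t + cliffN t)
     - cliffN s * (t * ddcliffJ t + dcliffJ t + cliffJ t)).
    by rewrite oJ oN !mulr0 subrr.
  by rewrite /f /f1 /f2; ring.
- by rewrite divr_gt0.
- by rewrite ltr_pM2r.
- by lra.
- by rewrite /f mulrC subrr.
- have pi0 : pi != 0 :> R := lt0r_neq0 (pi_gt0 R).
  rewrite /f; apply: (mulfI (invr_neq0 pi0)); rewrite mulr0 -[RHS]w0; ring.
have W := wronskian_cliffJN t0.
have Js : cliffJ s = 0.
  rewrite -[LHS]mulr1 -W.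
  transitivity (t * (cliffJ t * f1 t - dcliffJ t * f t)).
    by rewrite /f /f1; ring.
  by rewrite ft f1t !mulr0 subrr mulr0.
have Ns : cliffN s = 0.
  rewrite -[LHS]mulr1 -W.
  transitivity (t * (cliffN t * f1 t - dcliffN t * f t)).
    by rewrite /f /f1; ring.
  by rewrite ft f1t !mulr0 subrr mulr0.
have := wronskian_cliffJN s0.
by rewrite Js Ns mul0r !mulr0 subrr mulr0 => /eqP; rewrite eq_sym oner_eq0.
Qed.

Lemma continuous_sqr_half (x : R) : {for x, continuous (fun y : R => (y / 2) ^+ 2)}.
Proof.
apply: (@continuous_comp _ _ _ (fun y : R => y / 2) (fun y => y ^+ 2)).
  by apply: cvgMl; exact: cvg_id.
exact: sqr_continuous.
Qed.

Lemma continuous_besselJ0 : continuous (@besselJ0 R).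
Proof.
rewrite (funext besselJ0E) => x.
have cJ : {for (x / 2) ^+ 2, continuous (cliffJ)}.
  apply: differentiable_continuous; rewrite -derivable1_diffP.
  by have [] := is_derive_cliffJ ((x / 2) ^+ 2).
exact: (continuous_comp (@continuous_sqr_half x) cJ).
Qed.

Lemma continuous_besselY0 (x : R) : 0 < x -> {for x, continuous (@besselY0 R)}.
Proof.
move=> x0.
have -> : @besselY0 R = fun x => 2 / pi * (ln (x / 2) + euler_gamma) * besselJ0 x
    + 2 / pi * cliffH ((x / 2) ^+ 2).
  apply/funext => y; rewrite /besselY0; congr (_ + _ * _).
  rewrite /cliffH /psum /pseries; congr (limn (series _)).
  by apply/funext => n; rewrite exprM.
have c2 : {for x, continuous (fun x : R => x / 2)}.
  by apply: cvgMl; exact: cvg_id.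
have cH : {for (x / 2) ^+ 2, continuous (cliffH)}.
  apply: differentiable_continuous; rewrite -derivable1_diffP.
  by have [] := is_derive_cliffH ((x / 2) ^+ 2).
apply: cvgD; last first.
  by apply: cvgMr; exact: (continuous_comp (@continuous_sqr_half x) cH).
apply: cvgM; last exact: continuous_besselJ0.
apply: cvgMr; apply: cvgD; last exact: cvg_cst.
by apply: (continuous_comp c2); apply: continuous_ln; rewrite divr_gt0.
Qed.

End bessel_functions.

(** * Distances from an observation arc to the reference points *)

Section observation_geometry.
Context {R : realType}.
Implicit Types (N c lam a tau k : R) (m j : nat).

(** The law of cosines: the distance between two points of moduli 1 and [|lam|]
    on rays at an angle of cosine [c] ([lam] negative means the opposite ray). *)
Definition chord lam c : R := Num.sqrt (1 + lam ^+ 2 - 2 * lam * c).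

Lemma chord_gt0 lam c : lam != 1 -> 7 / 10 <= c <= 1 -> 0 < 1 + lam ^+ 2 - 2 * lam * c.
Proof.
move=> l1 /andP[c7 c1].
have : 0 < (lam - 1) ^+ 2 by rewrite exprn_even_gt0//= subr_eq0.
by have [l0|l0] := leP 0 lam; nra.
Qed.

(** The two regimes of [N = k R] and [lam = lambda_2] that wavenumbers produce.
    Apart from the position of a point on its arc, the observation geometry
    enters the bound only through these two numbers, which is why the constant of
    the theorem is uniform in [m] and [j]. *)
Definition admissible N lam :=
  12 <= N /\ lam = 1 / 2 + pi / (2 * N) \/ N = pi / 5 /\ lam = - (3 / 2).

Lemma pi_lt4 : pi < 4 :> R.
Proof. by have := @pihalf_lt2 R; lra. Qed.

(** In the first regime, the difference of the squared chords is divided by the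
    sum of the chords, which is bounded below by its value at [c = 1]; this gives
    [N |s1 - s2| <= pi / 2]. In the second regime both arguments lie in
    the interval from 0 to [pi / 2]. *)
Lemma chord_separation N lam c : admissible N lam -> 7 / 10 <= c <= 1 ->
  [/\ 0 < N * chord (1 / 2) c, 0 < N * chord lam c,
      N * chord (1 / 2) c != N * chord lam c &
      `|N * chord (1 / 2) c - N * chord lam c| < 2].
Proof.
move=> adm cI; have [c7 c1] := andP cI.
have pi0 := pi_gt0 R; have pi4 := pi_lt4.
have N0 : 0 < N by case: adm => -[]; lra.
have lam1 : lam != 1.
  case: adm => -[N12 ->]; last by lra.
  have : pi / (2 * N) < 1 / 2 by rewrite ltr_pdivrMr ?mulr_gt0//; lra.
  by lra.
have q1 : 0 < 1 + (1 / 2) ^+ 2 - 2 * (1 / 2) * c by apply: chord_gt0 => //; lra.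
have q2 := chord_gt0 lam1 cI.
have s10 : 0 < chord (1 / 2) c by rewrite sqrtr_gt0.
have s20 : 0 < chord lam c by rewrite sqrtr_gt0.
have s1E : chord (1 / 2) c ^+ 2 = 1 + (1 / 2) ^+ 2 - 2 * (1 / 2) * c.
  by rewrite sqr_sqrtr// ltW.
have s2E : chord lam c ^+ 2 = 1 + lam ^+ 2 - 2 * lam * c by rewrite sqr_sqrtr// ltW.
suff [sN Ns] : chord (1 / 2) c != chord lam c /\
    `|N * chord (1 / 2) c - N * chord lam c| < 2.
  split=> //; rewrite ?mulr_gt0//.
  by apply: contra sN => /eqP /(mulfI (lt0r_neq0 N0)) ->.
move: (chord (1 / 2) c) (chord lam c) s10 s20 s1E s2E => s1 s2 s10 s20 s1E s2E.
case: adm => -[NE lamE].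
- have [e [lE Ne e0 e6]] : exists e, [/\ lam = 1 / 2 + e, N * e = pi / 2, 0 < e & e <= 1 / 6].
    exists (pi / (2 * N)); split => //.
    + by move: (@pi R) => p; field; exact: lt0r_neq0.
    + by rewrite divr_gt0// mulr_gt0.
    + by rewrite ler_pdivrMr ?mulr_gt0//; lra.
  rewrite {}lE in s2E.
  have s12 : s1 ^+ 2 - s2 ^+ 2 = e * (2 * c - 1 - e) by rewrite s1E s2E; field.
  have ls1 : 1 / 2 <= s1 by nra.
  have ls2 : 1 / 2 - e <= s2 by nra.
  have lt21 : s2 < s1 by nra.
  split; first by rewrite gt_eqF.
  rewrite ger0_norm ?subr_ge0 ?ler_pM2l ?(ltW lt21)//.
  apply: (@le_lt_trans _ _ (pi / 2)); last by lra.
  rewrite -(ler_pM2r (addr_gt0 s10 s20)).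
  rewrite [leLHS](_ : _ = N * e * (2 * c - 1 - e)); last first.
    by rewrite -(mulrA N e) -s12; ring.
  by rewrite Ne ler_pM2l ?divr_gt0//; lra.
- have lt12 : s1 < s2 by rewrite lamE in s2E; nra.
  split; first by rewrite lt_eqF.
  rewrite ler0_norm ?subr_le0 ?ler_pM2l ?(ltW lt12)// opprB.
  have us2 : s2 <= 5 / 2 by rewrite lamE in s2E; nra.
  have : N * s2 <= N * (5 / 2) by rewrite ler_pM2l.
  have : 0 < N * s1 by rewrite mulr_gt0.
  by rewrite NE; lra.
Qed.

Lemma parameters_admissible a tau k : 0 < a -> 6 <= tau -> wavenumbers a k ->
  [/\ 0 < k, 6 * a <= obs_radius a tau k &
      admissible (k * obs_radius a tau k) (lambda a tau k 2)].
Proof.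
move=> a0 tau6; have pi0 := pi_gt0 R; have pi2 := pi_ge2 R.
have ks0 : 0 < kstar a by rewrite divr_gt0// mulr_gt0.
rewrite /lambda /obs_radius /=; case=> [[t /= t1 <-]|->]; last first.
  rewrite eqxx; split=> //; right; split=> //.
  by rewrite /kstar; move: (@pi R) => p; field; exact: lt0r_neq0.
have kk : kstar a < pi / a * t.
  apply: (@lt_le_trans _ _ (pi / a)); last by rewrite ler_peMr// divr_ge0 ?ltW.
  by rewrite ltr_pM2l// ltf_pV2 ?posrE ?mulr_gt0// ltr_pMl//; lra.
rewrite gt_eqF//; split; first exact: lt_trans kk.
  by rewrite ler_pM2r.
left; split; last by rewrite -(mulrA 2).
rewrite (_ : pi / a * t * (tau * a) = pi * (t * tau)).
  have ttau : 6 <= t * tau by nra.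
  by apply: (@le_trans _ _ (2 * 6)); [lra|exact: ler_pM].
by move: (@pi R) => p; field; exact: lt0r_neq0.
Qed.

(** Each arc has half opening [pi / m <= pi / 10], so twice the angle to its
    middle still has a nonnegative cosine and [c^2 >= 1/2], whence [c >= 7/10]. *)
Lemma arc_geometry a tau k m j (x : R * R) : 0 < obs_radius a tau k ->
  (10 <= m)%N -> (0 < j)%N -> boundary_arc a tau k m j x ->
  exists2 c, 7 / 10 <= c <= 1 & forall l,
    euclid_dist x (refpoint a tau k m j l)
    = obs_radius a tau k * chord (lambda a tau k l) c.
Proof.
move=> R0 m10 j0 [theta /andP[lo hi] <-].
set r := obs_radius a tau k in R0 *; set n := nu m (2 * j - 1) : R.
have m0 : 0 < m%:R :> R by rewrite ltr0n (leq_trans _ m10).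
have pi0 := pi_gt0 R.
pose h := pi / m%:R : R.
have h10 : h <= pi / 10 by rewrite ler_pM2l// lef_pV2 ?posrE// ler_nat.
have nuE s : nu m s = s%:R * h by rewrite /nu /h mulrA.
have nE : n = 2 * j%:R * h - h.
  by rewrite /n nuE natrB ?muln_gt0// natrM mulrBl mul1r.
have loE : nu m (2 * j - 2) = n - h.
  by rewrite nE nuE natrB ?leq_pmulr// natrM; move: (h : R) => p; ring.
have hiE : nu m (2 * j) = n + h by rewrite nE nuE natrM subrK.
exists (cos (theta - n)).
  rewrite cos_le1 andbT.
  have dlo : - (pi / 10) <= theta - n by lra.
  have dhi : theta - n <= pi / 10 by lra.
  have cge0 : 0 <= cos (theta - n) by apply: cos_ge0_pihalf; apply/andP; split; lra.
  have c2ge0 : 0 <= cos ((theta - n) + (theta - n)) by apply: cos_ge0_pihalf; apply/andP; split; lra.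
  rewrite cosD -!expr2 sin2cos2 in c2ge0; nra.
move=> l; rewrite /euclid_dist /refpoint /= -/r -/n /chord.
rewrite -[in RHS](ger0_norm (ltW R0)) -sqrtr_sqr -sqrtrM ?sqr_ge0//.
congr Num.sqrt; rewrite cosB.
have := cos2Dsin2 theta; have := cos2Dsin2 n.
move: (cos theta) (sin theta) (cos n) (sin n) (lambda a tau k l) => ct st cn sn lam n1 t1.
transitivity (r ^+ 2 * ((ct ^+ 2 + st ^+ 2) + lam ^+ 2 * (cn ^+ 2 + sn ^+ 2) - 2 * lam * (ct * cn + st * sn))).
  by ring.
by rewrite n1 t1; ring.
Qed.

End observation_geometry.

(** * Uniform bound on the condition number *)

Section stable_recovery.
Context {R : realType}.
Implicit Types (N lam c : R).

Definition cross_det N lam c : R :=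
  besselJ0 (N * chord (1 / 2) c) * besselY0 (N * chord lam c)
  - besselJ0 (N * chord lam c) * besselY0 (N * chord (1 / 2) c).

Definition bessel_energy N lam c : R :=
  besselJ0 (N * chord (1 / 2) c) ^+ 2 + besselY0 (N * chord (1 / 2) c) ^+ 2
  + besselJ0 (N * chord lam c) ^+ 2 + besselY0 (N * chord lam c) ^+ 2.

Lemma continuous_chord lam : continuous (@chord R lam).
Proof.
move=> c; rewrite /chord.
have cA : {for c, continuous (fun c : R => 1 + lam ^+ 2 - 2 * lam * c)}.
  apply: cvgB; first exact: cvg_cst.
  by apply: cvgMr; exact: cvg_id.
exact: (continuous_comp cA (@sqrt_continuous _ _)).
Qed.

(** For given [N] and [lam] the condition number is a continuous function of [c]
    on a segment, since its denominator does not vanish there. The bound is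
    chosen as a function of [N] and [lam]; outside the admissible pairs its
    value is arbitrary. *)
Lemma condition_number_bounded : exists K : R -> R -> R,
  (forall N lam, 0 < K N lam) /\
  forall N lam c, admissible N lam -> 7 / 10 <= c <= 1 ->
    bessel_energy N lam c / cross_det N lam c ^+ 2 <= K N lam.
Proof.
suff /choice[K KP] : forall p : R * R, exists K, 0 < K /\
    (admissible p.1 p.2 -> forall c, 7 / 10 <= c <= 1 ->
     bessel_energy p.1 p.2 c / cross_det p.1 p.2 c ^+ 2 <= K).
  exists (fun N lam => K (N, lam)); split=> [N lam|N lam c]; have [K0 KB] := KP (N, lam) => //.
  by move=> adm; exact: KB.
move=> [N lam] /=; have [adm|nadm] := pselect (admissible N lam); last first.
  by exists 1; split.
have [||c0 _ c0max] := @EVT_max R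
  (fun c => bessel_energy N lam c / cross_det N lam c ^+ 2) (7 / 10) 1.
- by lra.
- apply: continuous_in_subspaceT => c; rewrite inE/= in_itv/= => cI.
  have [p1 p2 p12 d12] := chord_separation adm cI.
  have w0 : cross_det N lam c != 0 by exact: bessel_cross_product_neq0.
  have cx mu : {for c, continuous (fun c => N * chord mu c)}.
    by apply: cvgMr; exact: continuous_chord.
  have cJ1 := continuous_comp (cx (1 / 2)) (@continuous_besselJ0 _ _).
  have cJ2 := continuous_comp (cx lam) (@continuous_besselJ0 _ _).
  have cY1 := continuous_comp (cx (1 / 2)) (continuous_besselY0 p1).
  have cY2 := continuous_comp (cx lam) (continuous_besselY0 p2).
  have sq (f : R -> R) : {for c, continuous f} -> {for c, continuous (fun c : R => f c ^+ 2)}.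
    by move=> cf; exact: (continuous_comp cf (@sqr_continuous _ _)).
  rewrite /bessel_energy; apply: cvgM.
    by apply: cvgD; [apply: cvgD; [apply: cvgD|]|]; exact: sq.
  apply: cvgV; first by rewrite sqrf_eq0.
  apply: sq; apply: cvgB; exact: cvgM.
exists (`|bessel_energy N lam c0 / cross_det N lam c0 ^+ 2| + 1); split.
  by rewrite ltr_wpDl.
move=> _ c cI; apply: (@le_trans _ _ (bessel_energy N lam c0 / cross_det N lam c0 ^+ 2)).
  by apply: c0max; rewrite in_itv.
by rewrite ler_wpDr// ler_norm.
Qed.

End stable_recovery.

(** * The three by three recovery system *)

Section recovery_system.
Context {R : realType}.
Implicit Types (a tau k : R) (m j l : nat) (x : R * R).

(** The three equations are the entries of [A S A^T], where [S] is the symmetric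
    matrix with entries [v1, v3, v2] and [A] has rows [(y_l, - j_l)]. Hence
    [S = A^-1 F A^-T], and [w = j1 y2 - j2 y1] is the determinant of
    [A]: each [v_i w^2] is a combination of the data with quadratic
    coefficients. *)
Lemma symmetric_system_bound (y1 j1 y2 j2 v1 v2 v3 f11 f22 f12 : R) :
  j1 * y2 - j2 * y1 != 0 ->
  y1 ^+ 2 * v1 + j1 ^+ 2 * v2 - 2 * y1 * j1 * v3 = f11 ->
  y2 ^+ 2 * v1 + j2 ^+ 2 * v2 - 2 * y2 * j2 * v3 = f22 ->
  y1 * y2 * v1 + j1 * j2 * v2 - (y1 * j2 + y2 * j1) * v3 = f12 ->
  `|v1| + `|v2| + `|v3| <=
    3 * ((j1 ^+ 2 + y1 ^+ 2 + j2 ^+ 2 + y2 ^+ 2) / (j1 * y2 - j2 * y1) ^+ 2)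
    * (`|f11| + `|f22| + `|f12|).
Proof.
move=> w0 e11 e22 e12.
set S := _ + _ + _ + _; set w := j1 * y2 - j2 * y1 in w0 *; set F := _ + _ + `|f12|.
have w2 : 0 < w ^+ 2 by rewrite exprn_even_gt0.
have SE : S = j1 * j1 + y1 * y1 + j2 * j2 + y2 * y2 by rewrite /S !expr2.
have bound v p q r : v * w ^+ 2 = p * f11 + q * f22 + r * f12 ->
    `|p| <= S -> `|q| <= S -> `|r| <= S -> `|v| <= S / w ^+ 2 * F.
  move=> e pS qS rS.
  rewrite mulrAC ler_pdivlMr// -[X in _ * X](gtr0_norm w2) -normrM e.
  apply: (le_trans (ler_normD _ _)); rewrite mulrDr lerD//; last by rewrite normrM ler_wpM2r.
  by apply: (le_trans (ler_normD _ _)); rewrite mulrDr lerD//; rewrite normrM ler_wpM2r.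
have j1s : 0 <= j1 * j1 by rewrite -expr2 sqr_ge0.
have j2s : 0 <= j2 * j2 by rewrite -expr2 sqr_ge0.
have y1s : 0 <= y1 * y1 by rewrite -expr2 sqr_ge0.
have y2s : 0 <= y2 * y2 by rewrite -expr2 sqr_ge0.
have sq (p q : R) : - (p * p + q * q) <= 2 * (p * q) <= p * p + q * q.
  by have := sqr_ge0 (p - q); have := sqr_ge0 (p + q); rewrite !expr2 => *; apply/andP; split; lra.
have [jj1 jj2] := andP (sq j1 j2); have [yy1 yy2] := andP (sq y1 y2).
have [jy11 jy12] := andP (sq j1 y1); have [jy21 jy22] := andP (sq j2 y2).
have [jz11 jz12] := andP (sq j1 y2); have [jz21 jz22] := andP (sq j2 y1).
have b1 : `|v1| <= S / w ^+ 2 * F.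
  apply: (bound _ (j2 ^+ 2) (j1 ^+ 2) (- (2 * (j1 * j2)))).
  - by rewrite -e11 -e22 -e12 /w; ring.
  - by rewrite ler_norml SE expr2; apply/andP; split; lra.
  - by rewrite ler_norml SE expr2; apply/andP; split; lra.
  - by rewrite ler_norml SE; apply/andP; split; lra.
have b2 : `|v2| <= S / w ^+ 2 * F.
  apply: (bound _ (y2 ^+ 2) (y1 ^+ 2) (- (2 * (y1 * y2)))).
  - by rewrite -e11 -e22 -e12 /w; ring.
  - by rewrite ler_norml SE expr2; apply/andP; split; lra.
  - by rewrite ler_norml SE expr2; apply/andP; split; lra.
  - by rewrite ler_norml SE; apply/andP; split; lra.
have b3 : `|v3| <= S / w ^+ 2 * F.
  apply: (bound _ (j2 * y2) (j1 * y1) (- (j1 * y2 + j2 * y1))).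
  - by rewrite -e11 -e22 -e12 /w; ring.
  - by rewrite ler_norml SE; apply/andP; split; lra.
  - by rewrite ler_norml SE; apply/andP; split; lra.
  - by rewrite ler_norml SE; apply/andP; split; lra.
by rewrite -mulrA; move: b1 b2 b3; move: (S / w ^+ 2 * F) => b; lra.
Qed.

Lemma norm2_le_sum (v : 'cV[R]_3) :
  norm2 v <= `|v 0 0| + `|v 1 0| + `|v (1 + 1) 0|.
Proof.
rewrite /norm2 !big_ord_recl big_ord0 addr0.
rewrite -[leRHS]ger0_norm ?addr_ge0// -sqrtr_sqr ler_sqrt ?sqr_ge0//.
rewrite -!(real_normK (num_real (v _ _))).
have -> : lift ord0 ord0 = 1 :> 'I_3 by exact/val_inj.
have -> : lift ord0 (lift ord0 ord0) = 1 + 1 :> 'I_3 by exact/val_inj.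
have := normr_ge0 (v 0 0); have := normr_ge0 (v 1 0); have := normr_ge0 (v (1 + 1) 0).
move: `|_| `|_| `|_| => x y z; nra.
Qed.

Lemma norm2_recovery_le a tau k m j x (V : 'cV[R]_3) (f11 f22 f12 : R) :
  let r l := euclid_dist x (refpoint a tau k m j l) in
  let Y l := besselY0 (k * r l) in
  let J l := besselJ0 (k * r l) in
  let w := J 1%N * Y 2%N - J 2%N * Y 1%N in
  w != 0 -> recovery_matrix a tau k m j x *m V = vec3 f11 f22 f12 ->
  norm2 V <= 3 * ((J 1%N ^+ 2 + Y 1%N ^+ 2 + J 2%N ^+ 2 + Y 2%N ^+ 2) / w ^+ 2)
             * (`|f11| + `|f22| + `|f12|).
Proof.
move=> r Y J w w0 DV.
have row (i : 'I_3) : \sum_(t < 3) recovery_matrix a tau k m j x i t * V t 0 = vec3 f11 f22 f12 i 0.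
  by rewrite -DV mxE.
have := row 0; have := row 1; have := row (1 + 1).
rewrite !mxE !big_ord_recl !big_ord0 !mxE /=.
have -> : lift ord0 ord0 = 1 :> 'I_3 by exact/val_inj.
have -> : lift ord0 (lift ord0 ord0) = 1 + 1 :> 'I_3 by exact/val_inj.
rewrite -/(r 1%N) -/(r 2%N) -/(Y 1%N) -/(Y 2%N) -/(J 1%N) -/(J 2%N).
move=> e12 e22 e11; apply: (le_trans (norm2_le_sum V)).
apply: symmetric_system_bound => //; [rewrite -e11|rewrite -e22|rewrite -e12]; ring.
Qed.

Lemma vec3B (p q r p' q' r' : R) :
  vec3 p q r - vec3 p' q' r' = vec3 (p - p') (q - q') (r - r').
Proof.
apply/matrixP => i j; rewrite !mxE.
by case: i => -[|[|[|//]]].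
Qed.

Lemma recovery_matrix_vec3 (a tau k : R) (m j : nat) (x : R * R) (p q s : R) :
  let r l := k * euclid_dist x (refpoint a tau k m j l) in
  let F l1 l2 := besselY0 (r l1) * besselY0 (r l2) * p
    + besselJ0 (r l1) * besselJ0 (r l2) * q
    - (besselY0 (r l1) * besselJ0 (r l2) + besselY0 (r l2) * besselJ0 (r l1)) * s in
  recovery_matrix a tau k m j x *m vec3 p q s
  = vec3 (F 1%N 1%N) (F 2%N 2%N) (F 1%N 2%N).
Proof.
move=> r F; apply/matrixP => i j'; rewrite mxE !big_ord_recl big_ord0 !mxE /=.
by case: i => -[|[|[|//]]] i3 /=; rewrite /F /r; ring.
Qed.

Lemma sum_ordered_pairs (F : nat -> nat -> R) :
  \sum_(1 <= l1 < 3) \sum_(l1 <= l2 < 3) F l1 l2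
  = F 1%N 1%N + F 1%N 2%N + F 2%N 2%N.
Proof. by rewrite big_ltn// big_nat1 big_ltn// !big_nat1. Qed.

End recovery_system.

(** * Moments of centered Gaussian variables *)

Section gaussian_moments.
Context {R : realType}.
Local Notation mu := (@lebesgue_measure R).

(** The normal law has its density as Radon-Nikodym derivative, because both
    have the same integral over every measurable set. *)
Lemma ge0_integral_normal_prob (m s : R) (f : R -> \bar R) :
  (forall x, 0 <= f x)%E -> measurable_fun setT f ->
  (\int[normal_prob m s]_x f x = \int[mu]_x (f x * (normal_pdf m s x)%:E))%E.
Proof.
move=> f0 mf; have dom := normal_prob_dominates m s.
rewrite -(Radon_Nikodym_SigmaFinite.change_of_variables dom f0)//.
have intf := Radon_Nikodym_SigmaFinite.f_integrable dom.
apply: ae_eq_integral => //.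
- by apply: emeasurable_funM => //; exact: measurable_int intf.
- apply: emeasurable_funM => //; apply/measurable_EFinP.
  exact: measurable_normal_pdf.
- apply: ae_eqe_mul2l; apply: integral_ae_eq => //.
  + by apply/measurable_EFinP; exact: measurable_normal_pdf.
  + by move=> E _ mE; rewrite -Radon_Nikodym_SigmaFinite.f_integral.
Qed.

(** Half of the exponent absorbs the power; the other half is, up to a factor,
    the density of the normal law with twice the variance. The constant comes from [y^2 / 2 <= exp y]
    with [y = x^2 / (4 s^2)]. *)
Lemma fourth_power_normal_pdf_le (s : R) : 0 < s ->
  exists2 K, 0 <= K & forall x,
    x ^+ 4 * normal_pdf 0 s x <= K * normal_pdf 0 (s * Num.sqrt 2) x.
Proof.
move=> s0; have q0 : 0 < Num.sqrt 2 :> R by rewrite sqrtr_gt0.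
have sq0 : s * Num.sqrt 2 != 0 by rewrite mulf_neq0 ?gt_eqF.
have pk0 := normal_peak_gt0 sq0.
exists (32 * s ^+ 4 * normal_peak s / normal_peak (s * Num.sqrt 2)).
  by rewrite divr_ge0 ?(ltW pk0)// !mulr_ge0 ?normal_peak_ge0 ?exprn_ge0// ltW.
move=> x; rewrite (normal_pdfE 0 (lt0r_neq0 s0)) (normal_pdfE 0 sq0) /= [leRHS]mulrA divfK ?gt_eqF//.
rewrite mulrCA [leRHS]mulrAC [leRHS]mulrC ler_wpM2l ?normal_peak_ge0//.
rewrite /normal_fun !subr0 exprMn sqr_sqrtr//.
set y := x ^+ 2 / (4 * s ^+ 2).
have y0 : 0 <= y by rewrite divr_ge0 ?sqr_ge0// mulr_ge0 ?sqr_ge0.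
have -> : - x ^+ 2 / (s ^+ 2 *+ 2) = - y - y.
  by rewrite /y -mulr_natl; field; rewrite gt_eqF.
have -> : - x ^+ 2 / (s ^+ 2 * 2 *+ 2) = - y.
  by rewrite /y -mulr_natl; field; rewrite gt_eqF.
have -> : x ^+ 4 = 16 * s ^+ 4 * y ^+ 2 by rewrite /y; field; rewrite gt_eqF.
rewrite expRD [leLHS](_ : _ = 16 * s ^+ 4 * expR (- y) * (y ^+ 2 * expR (- y))); last by ring.
rewrite [leRHS](_ : _ = 16 * s ^+ 4 * expR (- y) * 2); last by ring.
apply: ler_wpM2l; first by rewrite !mulr_ge0 ?expR_ge0 ?exprn_ge0// ltW.
rewrite expRN ler_pdivrMr ?expR_gt0//.
by have := expR_ge1Dxn 1 y0; rewrite (_ : 2`! = 2)//; lra.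
Qed.

Lemma normal_prob_fourth_moment (s : R) : 0 < s ->
  (\int[normal_prob 0 s]_x (x ^+ 4)%:E < +oo)%E.
Proof.
move=> s0; have [K K0 Kle] := fourth_power_normal_pdf_le s0.
rewrite ge0_integral_normal_prob//; last 2 first.
- by move=> x; rewrite lee_fin exprn_even_ge0.
- by apply/measurable_EFinP; exact: exprn_measurable.
apply: (@le_lt_trans _ _ (\int[mu]_x (K%:E * (normal_pdf 0 (s * Num.sqrt 2) x)%:E))%E).
  apply: ge0_le_integral => //.
  - by move=> x _; rewrite -EFinM lee_fin mulr_ge0 ?normal_pdf_ge0// exprn_even_ge0.
  - rewrite -[X in measurable_fun _ X]/(EFin \o (fun x => x ^+ 4 * normal_pdf 0 s x)).
    apply/measurable_EFinP; apply: measurable_funM; first exact: exprn_measurable.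
    exact: measurable_normal_pdf.
  - by apply/measurable_EFinP; apply: measurable_funM => //; exact: measurable_normal_pdf.
  - by move=> x _; rewrite -!EFinM lee_fin.
have ipdf := @integrable_normal_pdf R 0 (s * Num.sqrt 2).
by rewrite integralZl//= integral_normal_pdf mule1 ltry.
Qed.

End gaussian_moments.

Section square_integrability.
Context {R : realType} d {T : measurableType d} (P : probability T R).

Lemma Lfun2P (mu : {measure set T -> \bar R}) (f : T -> R) :
  measurable_fun setT f -> mu.-integrable setT (EFin \o (fun x => f x ^+ 2)) ->
  f \in Lfun mu 2%:E.
Proof.
move=> mf /integrableP[_ fi]; rewrite inE; apply/andP; split; first by rewrite inE.
rewrite inE/= /finite_norm unlock poweR_lty//.
apply: le_lt_trans fi; apply: ge0_le_integral => //=.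
- apply/measurable_EFinP.
  apply: (measurableT_comp (measurable_powR _)) => //.
  exact: measurableT_comp.
- by apply/measurable_EFinP; apply: measurableT_comp => //; exact: measurable_funX.
- by move=> x _; rewrite lee_fin powR_mulrn// normrX.
Qed.

Lemma sqr_centered_gaussian_Lfun2 (X : {RV P >-> R}) :
  centered_gaussian P X -> (fun w => X w ^+ 2) \in Lfun P 2%:E.
Proof.
move=> gX; have mX4 : measurable_fun setT (fun w => (X w ^+ 2) ^+ 2).
  by do 2 apply: measurable_funX.
apply: Lfun2P; first exact: measurable_funX.
apply/integrableP; split; first exact/measurable_EFinP.
have -> : (\int[P]_w `|(EFin \o (fun w => (X w ^+ 2) ^+ 2)%R) w| =
    \int[P]_w ((X w ^+ 4)%R)%:E)%E.
  by apply: eq_integral => w _; rewrite /= ger0_norm ?sqr_ge0// -exprM.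
case: gX => [X0|[s s0 Xs]].
  rewrite (ae_eq_integral (cst 0%E))//.
  - by rewrite integral0.
  - by apply/measurable_EFinP; exact: measurable_funX.
  - by apply: filterS X0 => w -> _; rewrite expr0n.
apply: le_lt_trans (normal_prob_fourth_moment s0).
(* Real random variables and the Lebesgue measure use two presentations of the
   Borel sets, with the same measurable sets but distinct displays. *)
have mX : @measurable_fun _ _ T (measurableTypeR R) setT X.
  by move=> mT B mB; exact: (@measurable_funP _ _ _ _ setT X) mT B mB.
have := @ge0_integral_pushforward _ _ T (measurableTypeR R) R _ mX P setT
  (fun x : R => (x ^+ 4)%:E) measurableT.
rewrite preimage_setT => <-.
- by rewrite [leLHS](eq_measure_integral (normal_prob 0 s)) => [|A mA _]; [exact: lexx|exact: Xs].
- by apply/measurable_EFinP; exact: exprn_measurable.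
- by move=> y _; rewrite lee_fin exprn_even_ge0.
Qed.

Lemma centered_gaussian_Lfun2 (X : {RV P >-> R}) :
  centered_gaussian P X -> (X : T -> R) \in Lfun P 2%:E.
Proof.
move=> /sqr_centered_gaussian_Lfun2 X2; apply: Lfun2P => //.
apply/Lfun1_integrable/Lfun_subset12 => //.
exact: fin_num_measure.
Qed.

End square_integrability.

(** * Square integrability of the Wiener integrands *)

Section wiener_integrand.
Context {R : realType}.
Implicit Types (a k : R) (x y : R * R).
Local Notation mu2 := (@lebesgue2 R).

Definition sqdist x y : R := (x.1 - y.1) ^+ 2 + (x.2 - y.2) ^+ 2.

Lemma Omega0E a : Omega0 a = `]- a, a[ `*` `]- a, a[.
Proof. by apply/seteqP; split=> y; rewrite /Omega0 /= !in_itv. Qed.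

Lemma measurable_Omega0 a : @measurable _ (measurableTypeR R * measurableTypeR R)%type (Omega0 a).
Proof. by rewrite Omega0E; exact: measurableX. Qed.

Lemma lebesgue2_Omega0_lty a : (mu2 (Omega0 a) < +oo)%E.
Proof.
rewrite Omega0E /lebesgue2 product_measure1E//.
have fin_itv : @lebesgue_measure R `]- a, a[ \is a fin_num.
  by rewrite lebesgue_measure_itv/=; case: ifP.
by rewrite ltey_eq fin_numM.
Qed.

Lemma sqdist_bounds a x y : 36 * a ^+ 2 <= x.1 ^+ 2 + x.2 ^+ 2 ->
  Omega0 a y ->
  16 * a ^+ 2 <= sqdist x y <= 2 * (x.1 ^+ 2 + x.2 ^+ 2) + 4 * a ^+ 2.
Proof.
move=> xa [/andP[y11 y12] /andP[y21 y22]]; rewrite /sqdist.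
have y1a : y.1 ^+ 2 <= a ^+ 2 by nra.
have y2a : y.2 ^+ 2 <= a ^+ 2 by nra.
have := sqr_ge0 (x.1 - 2 * y.1); have := sqr_ge0 (x.2 - 2 * y.2).
have := sqr_ge0 (x.1 + y.1); have := sqr_ge0 (x.2 + y.2).
by rewrite !expr2 in xa y1a y2a * => *; apply/andP; split; lra.
Qed.

(** On the source region the squared distance to [x] stays in a compact subset of
    the positive axis, on which [phi] is bounded; the singularity of [phi] at 0
    is not seen. Integrability of [sigma ^ 4] gives that of [sigma ^ 2] since the
    region has finite measure. *)
Lemma Lp_on_radial_mul a x (phi : R -> R) (sigma : R * R -> R) : 0 < a ->
  36 * a ^+ 2 <= x.1 ^+ 2 + x.2 ^+ 2 ->
  (forall t, 0 < t -> {for t, continuous phi}) ->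
  Lp_on (Omega0 a) 4 sigma ->
  Lp_on (Omega0 a) 2 (fun y => phi (sqdist x y) * sigma y).
Proof.
move=> a0 xa cphi; rewrite /Lp_on => s4.
set D := Omega0 a in s4 *.
have mD : @measurable _ (measurableTypeR R * measurableTypeR R)%type D := measurable_Omega0 a.
pose lo := 16 * a ^+ 2; pose hi := 2 * (x.1 ^+ 2 + x.2 ^+ 2) + 4 * a ^+ 2.
have lo0 : 0 < lo by rewrite mulr_gt0// exprn_gt0.
have ms : @measurable_fun _ _ (measurableTypeR R * measurableTypeR R)%type R setT (sigma \_ D).
  by have := s4; rewrite inE => /andP[]; rewrite inE.
have [K K0 phiK] : exists2 K, 0 <= K & forall y, D y -> `|phi (sqdist x y)| <= K.
  have [||c cI cmax] := @EVT_max R (fun t => `|phi t|) lo hi.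
    by rewrite /lo /hi; nra.
    apply: continuous_in_subspaceT => t; rewrite inE/= in_itv/= => /andP[t1 _].
    exact: (continuous_comp (cphi t (lt_le_trans lo0 t1)) (@norm_continuous _ _ _)).
  exists `|phi c| => // y Dy; apply: cmax; rewrite in_itv/=.
  exact: (sqdist_bounds xa Dy).
have mphi : @measurable_fun _ _ (measurableTypeR R * measurableTypeR R)%type R setT
    ((fun y => phi (sqdist x y)) \_ D).
  apply: (measurable_restrictT _ mD).1.
  have sub : sqdist x @` D `<=` `]0, +oo[.
    move=> _ [y Dy <-]; rewrite /= in_itv/= andbT.
    by have /andP[+ _] := sqdist_bounds xa Dy; exact: lt_le_trans.
  have mp : measurable_fun (`]0, +oo[ : set R) phi.
    apply: open_continuous_measurable_fun; first exact: interval_open.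
    by move=> t; rewrite inE/= in_itv/= andbT => /cphi.
  have mq : @measurable_fun _ _ (measurableTypeR R * measurableTypeR R)%type R D (sqdist x).
    apply: measurable_funTS; rewrite /sqdist.
    by apply: measurable_funD; apply: measurable_funX; apply: measurable_funB.
  exact: (measurable_comp (measurable_itv _) sub mp mq).
have pE : (fun y => phi (sqdist x y) * sigma y) \_ D
    = (fun y => ((fun y => phi (sqdist x y)) \_ D) y * (sigma \_ D) y).
  apply/funext => y; rewrite !patchE; case: ifP => // _; by rewrite mul0r.
rewrite pE; apply: Lfun2P; first exact: measurable_funM.
apply: (@le_integrable _ _ _ mu2 setT measurableT _
  (fun y => (K ^+ 2 * (\1_D y + (sigma \_ D) y ^+ 4))%:E)) => //.
- apply/measurable_EFinP; apply: measurable_funX; exact: measurable_funM.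
- move=> y _; rewrite lee_fin.
  rewrite !ger0_norm ?sqr_ge0 ?mulr_ge0 ?addr_ge0 ?exprn_even_ge0//.
  rewrite indicE !patchE; case: ifPn => [yD|_]; last first.
    by rewrite mul0r expr0n/= !mulr_ge0 ?sqr_ge0 ?addr_ge0 ?exprn_even_ge0.
  have p2 : phi (sqdist x y) ^+ 2 <= K ^+ 2.
    by rewrite -(real_normK (num_real (phi _))) ler_sqr ?nnegrE// phiK// -inE.
  have s2 : sigma y ^+ 2 <= 1 + sigma y ^+ 4.
    rewrite (_ : sigma y ^+ 4 = (sigma y ^+ 2) ^+ 2) -?exprM//.
    by have := sqr_ge0 (sigma y ^+ 2 - 1); have := sqr_ge0 (sigma y); nra.
  by rewrite exprMn ler_pM ?sqr_ge0.
have i1 : mu2.-integrable setT (EFin \o (\1_D : R * R -> R)).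
  apply/integrableP; split; first exact/measurable_EFinP/measurable_indic.
  under eq_integral => y _ do rewrite /= ger0_norm//.
  by rewrite integral_indic// setIT; exact: lebesgue2_Omega0_lty.
have i4 : mu2.-integrable setT (EFin \o (fun y => (sigma \_ D) y ^+ 4)).
  have := @Lfun_integrable _ _ _ mu2 _ 4 _ s4; rewrite ler1n => /(_ isT).
  by apply: eq_integrable => // y _ /=; rewrite powR_mulrn// -normrX ger0_norm// exprn_even_ge0.
have := integrableZl measurableT (K ^+ 2) (integrableD measurableT i1 i4).
by apply: eq_integrable.
Qed.

End wiener_integrand.

(** * Bilinearity of the covariance and the Green function *)

Section covariance_calculus.
Context {R : realType} d {T : measurableType d} (P : probability T R).
Implicit Types (X Y Z : T -> R) (c : R).
Local Notation L2 := (Lfun P 2%:E).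

Lemma Lfun2D X Y : X \in L2 -> Y \in L2 -> (fun w => X w + Y w) \in L2.
Proof. by move=> X2 Y2; exact: (@Lfun_addr_closed _ _ _ P _ (lee1n 2)).2. Qed.

Lemma Lfun2Z c X : X \in L2 -> (fun w => c * X w) \in L2.
Proof.
move=> X2; rewrite (_ : (fun w => _) = c \o* X); last by apply/funext => w; rewrite /= mulrC.
by apply: Lfun_scale => //; rewrite ler1n.
Qed.

Lemma Lfun2_Lfun1 X : X \in L2 -> X \in Lfun P 1.
Proof. by apply: Lfun_subset12; exact: fin_num_measure. Qed.

Lemma rcov_fin X Y : X \in L2 -> Y \in L2 -> covariance P X Y \is a fin_num.
Proof.
move=> X2 Y2; apply: covariance_fin_num; [exact: Lfun2_Lfun1..|].
exact: Lfun2_mul_Lfun1.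
Qed.

Lemma rcovC X Y : rcov P X Y = rcov P Y X.
Proof. by rewrite /rcov covarianceC. Qed.

Lemma rcovDl X Y Z : X \in L2 -> Y \in L2 -> Z \in L2 ->
  rcov P (fun w => X w + Y w) Z = rcov P X Z + rcov P Y Z.
Proof.
move=> X2 Y2 Z2; rewrite /rcov -fineD ?rcov_fin//; congr fine.
exact: covarianceDl.
Qed.

Lemma rcovZl c X Y : X \in L2 -> Y \in L2 ->
  rcov P (fun w => c * X w) Y = c * rcov P X Y.
Proof.
move=> X2 Y2; rewrite /rcov (_ : (fun w => _) = c \o* X); last first.
  by apply/funext => w; rewrite /= mulrC.
have X1 := Lfun2_Lfun1 X2; have Y1 := Lfun2_Lfun1 Y2.
have XY1 := Lfun2_mul_Lfun1 X2 Y2.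
by rewrite covarianceZl// fineM ?rcov_fin.
Qed.

Lemma rcov_cstl c X : rcov P (fun=> c) X = 0.
Proof. by rewrite /rcov covariance_cst_l. Qed.

Definition affine2 c p q X Y := fun w : T => c + (p * X w + q * Y w).

Lemma affine2_Lfun2 c p q X Y : X \in L2 -> Y \in L2 -> affine2 c p q X Y \in L2.
Proof.
move=> X2 Y2; apply: Lfun2D; last by apply: Lfun2D; exact: Lfun2Z.
exact: Lfun_cst.
Qed.

Lemma rcov_affine2l c p q X Y Z : X \in L2 -> Y \in L2 -> Z \in L2 ->
  rcov P (affine2 c p q X Y) Z = p * rcov P X Z + q * rcov P Y Z.
Proof.
move=> X2 Y2 Z2; rewrite rcovDl ?Lfun_cst//; last by apply: Lfun2D; exact: Lfun2Z.
by rewrite rcov_cstl add0r rcovDl ?Lfun2Z// !rcovZl.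
Qed.

Lemma rcov_affine2 c1 p1 q1 c2 p2 q2 X Y : X \in L2 -> Y \in L2 ->
  rcov P (affine2 c1 p1 q1 X Y) (affine2 c2 p2 q2 X Y) =
  p1 * p2 * rvar P X + q1 * q2 * rvar P Y + (p1 * q2 + q1 * p2) * rcov P X Y.
Proof.
move=> X2 Y2; have A2 := affine2_Lfun2 c2 p2 q2 X2 Y2.
rewrite rcov_affine2l// !(rcovC _ (affine2 _ _ _ _ _)) !rcov_affine2l//.
by rewrite (rcovC Y X) /rvar /variance -/(rcov P X X) -/(rcov P Y Y); ring.
Qed.

(** This removes the variance of [U], hence, when [U = |u|^2], all moments of [u]
    of order higher than 2. *)
Lemma rcov_second_difference U X1 X2 :
  U \in L2 -> X1 \in L2 -> X2 \in L2 ->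
  rcov P (fun w => U w + X1 w) (fun w => U w + X2 w)
  - rcov P U (fun w => U w + X1 w) - rcov P U (fun w => U w + X2 w)
  + rvar P U = rcov P X1 X2.
Proof.
move=> U2 X12 X22; have S1 := Lfun2D U2 X12; have S2 := Lfun2D U2 X22.
rewrite rcovDl// !(rcovC _ (fun w => U w + _)) !rcovDl//.
rewrite (rcovC X1 U) (rcovC X2 X1) (rcovC X2 U).
by rewrite /rvar /variance -/(rcov P U U); ring.
Qed.

Lemma sqr_shift_Lfun2 c X : X \in L2 -> (fun w => X w ^+ 2) \in L2 ->
  (fun w => (c + X w) ^+ 2) \in L2.
Proof.
move=> X2 XX2.
rewrite (_ : (fun w => _) = fun w => affine2 (c ^+ 2) (2 * c) 1 X (fun w => X w ^+ 2) w).
  exact: affine2_Lfun2.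
by apply/funext => w; rewrite /affine2; ring.
Qed.

End covariance_calculus.

Section green_function.
Context {R : realType}.

Lemma greenE (k : R) (x y : R * R) :
  green k x y = (besselY0 (k * euclid_dist x y) / 4)
             +i* (- (besselJ0 (k * euclid_dist x y) / 4)).
Proof.
rewrite /green /hankel0 -(rmorph_nat (real_complex R)) -fmorphV /=.
move: (besselJ0 _) (besselY0 _) => j y0.
by apply/eqP; rewrite eq_complex /= !mul0r; apply/andP; split; apply/eqP; field.
Qed.

Lemma sqmodE d (T : measurableType d) (X : T -> R[i]) w :
  sqmod X w = complex.Re (X w) ^+ 2 + complex.Im (X w) ^+ 2.
Proof.
rewrite /sqmod; case: (X w) => p q /=.
by rewrite sqr_sqrtr// addr_ge0 ?sqr_ge0.
Qed.

End green_function.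

(** * Second differences of the phaseless covariances *)

Section radiated_field.
Context {R : realType} d {T : measurableType d} (P : probability T R)
  (W : (R * R -> R) -> {RV P >-> R}) (a k : R) (g sigma : R * R -> R)
  (a0 : 0 < a) (k0 : 0 < k) (noise : white_noise (Omega0 a) W)
  (sigma4 : Lp_on (Omega0 a) 4 sigma).

Lemma wiener_Lfun2 (f : R * R -> R) : Lp_on (Omega0 a) 2 f ->
  ((W f : T -> R) \in Lfun P 2%:E) * ((fun w => W f w ^+ 2) \in Lfun P 2%:E).
Proof.
move=> f2; have [gauss _] := noise.
have Wf : centered_gaussian P (W f).
  have <- : (fun w => \sum_(i < 1) 1 * W f w) = W f.
    by apply/funext => w; rewrite big_ord1 mul1r.
  exact: (gauss 1%N (fun=> f) (fun=> 1) (fun=> f2)).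
by split; [exact: centered_gaussian_Lfun2|exact: sqr_centered_gaussian_Lfun2].
Qed.

Context (x : R * R) (xa : 36 * a ^+ 2 <= x.1 ^+ 2 + x.2 ^+ 2).
Let u : T -> R[i] := radiated W a g sigma k x.

(** Real and imaginary parts of [u] are constants plus single Wiener integrals,
    so the square integrability of [|u|^2] needs no joint law. *)
Lemma radiated_Lfun2 : [/\ (fun w => complex.Re (u w)) \in Lfun P 2%:E,
  (fun w => complex.Im (u w)) \in Lfun P 2%:E & sqmod u \in Lfun P 2%:E].
Proof.
have cdist (f : R -> R) : (forall t, 0 < t -> {for t, continuous f}) ->
    forall t, 0 < t -> {for t, continuous (fun t => f (k * Num.sqrt t))}.
  move=> cf t t0; have c1 : {for t, continuous (fun t => k * Num.sqrt t)}.
    by apply: cvgMr; exact: sqrt_continuous.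
  by apply: (continuous_comp c1); apply: cf; rewrite mulr_gt0 ?sqrtr_gt0.
have L2re : Lp_on (Omega0 a) 2 (fun y => complex.Re (green k x y * (sigma y)%:C)).
  rewrite (_ : (fun y => _) =
      fun y => (besselY0 (k * Num.sqrt (sqdist x y)) / 4) * sigma y).
    apply: (@Lp_on_radial_mul _ a x (fun t => besselY0 (k * Num.sqrt t) / 4)) => //.
    move=> t t0; apply: cvgMl.
    by apply: (cdist besselY0) => // s; exact: continuous_besselY0.
  by apply/funext => y; rewrite greenE /= mulr0 subr0.
have L2im : Lp_on (Omega0 a) 2 (fun y => complex.Im (green k x y * (sigma y)%:C)).
  rewrite (_ : (fun y => _) =
      fun y => (- (besselJ0 (k * Num.sqrt (sqdist x y)) / 4)) * sigma y).
    apply: (@Lp_on_radial_mul _ a x (fun t => - (besselJ0 (k * Num.sqrt t) / 4))) => //.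
    move=> t t0; apply: cvgN; apply: cvgMl.
    by apply: (cdist besselJ0) => // s _; exact: continuous_besselJ0.
  by apply/funext => y; rewrite greenE /= mulr0 add0r.
have [re2 rere2] := wiener_Lfun2 L2re; have [im2 imim2] := wiener_Lfun2 L2im.
set c := complex_integral (Omega0 a) (fun y => green k x y * (g y)%:C).
have reE w : complex.Re (u w) = complex.Re c
    + W (fun y => complex.Re (green k x y * (sigma y)%:C)) w.
  by rewrite /u /radiated -/c /complex_wiener; move: (c) => [].
have imE w : complex.Im (u w) = complex.Im c
    + W (fun y => complex.Im (green k x y * (sigma y)%:C)) w.
  by rewrite /u /radiated -/c /complex_wiener; move: (c) => [].
split.
- by rewrite (funext reE); apply: Lfun2D => //; exact: Lfun_cst.
- by rewrite (funext imE); apply: Lfun2D => //; exact: Lfun_cst.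
- rewrite (_ : sqmod u = fun w => (complex.Re c
      + W (fun y => complex.Re (green k x y * (sigma y)%:C)) w) ^+ 2 + (complex.Im c
    + W (fun y => complex.Im (green k x y * (sigma y)%:C)) w) ^+ 2).
    by apply: Lfun2D; exact: sqr_shift_Lfun2.
  by apply/funext => w; rewrite sqmodE reE imE.
Qed.

(** At reference points [z1] and [z2], the right-hand side is a row of the
    recovery system applied to the exact moments of [u]. *)
Lemma second_difference_radiated (z1 z2 : R * R) :
  let r z := k * euclid_dist x z in
  let v z := fun w => u w + green k x z in
  4 * (rcov P (sqmod (v z1)) (sqmod (v z2)) - rcov P (sqmod u) (sqmod (v z1))
       - rcov P (sqmod u) (sqmod (v z2)) + rvar P (sqmod u)) =
  besselY0 (r z1) * besselY0 (r z2) * rvar P (fun w => complex.Re (u w))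
  + besselJ0 (r z1) * besselJ0 (r z2) * rvar P (fun w => complex.Im (u w))
  - (besselY0 (r z1) * besselJ0 (r z2) + besselY0 (r z2) * besselJ0 (r z1))
    * rcov P (fun w => complex.Re (u w)) (fun w => complex.Im (u w)).
Proof.
move=> r v; have [re2 im2 u2] := radiated_Lfun2.
pose X z := affine2 ((besselY0 (r z) / 4) ^+ 2 + (besselJ0 (r z) / 4) ^+ 2)
  (besselY0 (r z) / 2) (- (besselJ0 (r z) / 2))
  (fun w => complex.Re (u w)) (fun w => complex.Im (u w)).
have vE : forall z, sqmod (v z) = fun w => sqmod u w + X z w.
  move=> z; apply/funext => w; rewrite !sqmodE /v greenE /X /affine2 -/(r z).
  by case: (u w) => p q /=; field.
have X2 : forall z, X z \in Lfun P 2%:E by move=> z; exact: affine2_Lfun2.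
rewrite !vE rcov_second_difference//.
by rewrite /X rcov_affine2//; field.
Qed.

End radiated_field.

(** * The stability estimate *)

Theorem theorem2p4 (R : realType) :
  exists C : R -> R -> R -> R -> R -> R,
    (forall p1 p2 p3 p4 p5 : R, 0 < C p1 p2 p3 p4 p5) /\
    forall (a tau k : R) (m j : nat) (g sigma : R * R -> R)
      (d : measure_display) (T : measurableType d) (P : probability T R)
      (W : (R * R -> R) -> {RV P >-> R}),
    0 < a -> 6 <= tau -> wavenumbers a k -> (10 <= m)%N -> (1 <= j <= m)%N ->
    compactly_supported_in (Omega0 a) g ->
    compactly_supported_in (Omega0 a) sigma ->
    Lp_on (Omega0 a) 2 g -> Lp_on (Omega0 a) 4 sigma ->
    (forall y, 0 <= sigma y) ->
    white_noise (Omega0 a) W ->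
    let u x : T -> R[i] := radiated W a g sigma k x in
    let v l x : T -> R[i] :=
      fun w => u x w + green k x (refpoint a tau k m j l) in
    forall (cov_vv : nat -> nat -> R * R -> R) (cov_uv : nat -> R * R -> R)
      (var_u : R * R -> R) (Veps : R * R -> 'cV[R]_3),
    let F l1 l2 x :=
      4 * (cov_vv l1 l2 x - cov_uv l1 x - cov_uv l2 x + var_u x) in
    (forall x, boundary_arc a tau k m j x ->
      recovery_matrix a tau k m j x *m Veps x
      = vec3 (F 1%N 1%N x) (F 2%N 2%N x) (F 1%N 2%N x)) ->
    forall x, boundary_arc a tau k m j x ->
    let Delta_vv l1 l2 :=
      cov_vv l1 l2 x - rcov P (sqmod (v l1 x)) (sqmod (v l2 x)) in
    let Delta_uv l := cov_uv l x - rcov P (sqmod (u x)) (sqmod (v l x)) in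
    let Delta_uu := var_u x - rvar P (sqmod (u x)) in
    let re_u w := complex.Re (u x w) in
    let im_u w := complex.Im (u x w) in
    let V := vec3 (rvar P re_u) (rvar P im_u) (rcov P re_u im_u) in
    norm2 (Veps x - V) <=
      C k (obs_radius a tau k) ((20 * tau - 7) / (20 * tau)) (4 / 9)
        (lambda a tau k 2) *
      \sum_(1 <= l1 < 3) \sum_(l1 <= l2 < 3)
        (`|Delta_vv l1 l2| + `|Delta_uv l1| + `|Delta_uv l2| + `|Delta_uu|).
Proof.
have [K [K0 KP]] := @condition_number_bounded R.
exists (fun p1 p2 _ _ p5 => 12 * K (p1 * p2) p5); split.
  by move=> p1 p2 _ _ p5; rewrite mulr_gt0.
move=> a tau k m j g sigma d T P W a0 tau6 kK m10 /andP[j1 jm] _ _ _ sigma4 _ noise.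
move=> u v cov_vv cov_uv var_u Veps F DVeps x xarc.
pose Dvv l1 l2 := cov_vv l1 l2 x - rcov P (sqmod (v l1 x)) (sqmod (v l2 x)).
pose Duv l := cov_uv l x - rcov P (sqmod (u x)) (sqmod (v l x)).
pose Duu := var_u x - rvar P (sqmod (u x)).
pose V := vec3 (rvar P (fun w => complex.Re (u x w)))
  (rvar P (fun w => complex.Im (u x w)))
  (rcov P (fun w => complex.Re (u x w)) (fun w => complex.Im (u x w))).
change (norm2 (Veps x - V) <= 12 * K (k * obs_radius a tau k) (lambda a tau k 2) *
  \sum_(1 <= l1 < 3) \sum_(l1 <= l2 < 3)
    (`|Dvv l1 l2| + `|Duv l1| + `|Duv l2| + `|Duu|)).
have [k0 R6 adm] := parameters_admissible a0 tau6 kK.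
have R0 : 0 < obs_radius a tau k by rewrite (lt_le_trans _ R6)// mulr_gt0.
have [c cI distE] := arc_geometry R0 m10 j1 xarc.
have xa : 36 * a ^+ 2 <= x.1 ^+ 2 + x.2 ^+ 2.
  have [theta _ <-] := xarc; rewrite /= !exprMn -mulrDr cos2Dsin2 mulr1; nra.
have NE l : k * euclid_dist x (refpoint a tau k m j l)
    = k * obs_radius a tau k * chord (lambda a tau k l) c by rewrite distE mulrA.
have exact_data := second_difference_radiated g a0 k0 noise sigma4 xa.
have DV : recovery_matrix a tau k m j x *m (Veps x - V) = vec3
    (4 * (Dvv 1%N 1%N - Duv 1%N - Duv 1%N + Duu))
    (4 * (Dvv 2%N 2%N - Duv 2%N - Duv 2%N + Duu))
    (4 * (Dvv 1%N 2%N - Duv 1%N - Duv 2%N + Duu)).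
  rewrite mulmxBr DVeps// recovery_matrix_vec3 -!exact_data vec3B.
  have split4 (p q r s p' q' r' s' : R) :
      4 * (p - q - r + s) - 4 * (p' - q' - r' + s')
      = 4 * ((p - p') - (q - q') - (r - r') + (s - s')) by ring.
  by congr vec3; exact: split4.
have w0 : cross_det (k * obs_radius a tau k) (lambda a tau k 2) c != 0.
  have [p1 p2 p12 d12] := chord_separation adm cI.
  exact: bessel_cross_product_neq0.
have KB := KP _ _ _ adm cI.
have := norm2_recovery_le _ DV; rewrite !NE => /(_ w0) /le_trans; apply.
rewrite sum_ordered_pairs.
move: (Dvv 1%N 1%N) (Dvv 2%N 2%N) (Dvv 1%N 2%N) (Duv 1%N) (Duv 2%N) (Duu).
move=> vv11 vv22 vv12 uv1 uv2 uu; set err := _ + _ + (_ + `|uu|).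
(* The factor 12 splits into 3, from the recovery bound, and 4, from the scaling
   of the data. *)
rewrite [leRHS](_ : _ = 3 * K (k * obs_radius a tau k) (lambda a tau k 2) * (4 * err)).
  2: by ring.
apply: ler_pM.
- by rewrite mulr_ge0// divr_ge0 ?sqr_ge0// !addr_ge0 ?sqr_ge0.
- by rewrite !addr_ge0.
- by rewrite ler_pM2l.
have norm4 (z : R) : `|4 * z| = 4 * `|z| by rewrite normrM ger0_norm.
rewrite !norm4 -!mulrDr ler_pM2l// /err.
have tri (p q r s : R) : `|p - q - r + s| <= `|p| + `|q| + `|r| + `|s|.
  apply: (le_trans (ler_normD _ _)); rewrite lerD2r.
  apply: (le_trans (ler_normB _ _)); rewrite lerD2r.
  exact: ler_normB.
by rewrite addrAC !lerD ?tri.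
Qed.
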